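(* Let $(X,G)$ be a $G$-metric space, let $m\ge 1$, let $X_1,\dots,X_m$ be nonempty subsets of $X$, and let $T:\bigcup_{i=1}^m X_i\to\bigcup_{i=1}^m X_i$ be a G-Mohseni cyclical operator. Then for every $\epsilon>0$, $T$ has an $\epsilon$-fixed point.
   Context: A $G$-metric on a nonempty set $X$ is a function $G:X\times X\times X\to[0,\infty)$ such that: (G1) $G(x,y,z)=0$ if and only if $x=y=z$; (G2) $0<G(x,x,y)$ for all $x,y\in X$ with $x\neq y$; (G3) $G(x,x,y)\le G(x,y,z)$ for all $x,y,z\in X$ with $z\ne y$; (G4) $G$ is symmetric in its three variables (invariant under all permutations of its arguments); (G5) $G(x,y,z)\le G(x,a,a)+G(a,y,z)$ for all $x,y,z,a\in X$. The pair $(X,G)$ is called a $G$-metric space (completeness is not assumed). With the convention $X_{m+1}=X_1$, a map $T:\bigcup_{i=1}^m X_i\to\bigcup_{i=1}^m X_i$ is a cyclical operator if $T(X_i)\subseteq X_{i+1}$ for all $i=1,\dots,m$. A G-Mohseni cyclical operator is a cyclical operator $T$ for which there exists $\alpha\in(0,\frac12)$ such that for all $i\in\{1,\dots,m\}$, $x\in X_i$, $y\in X_{i+1}$, $$G(Tx,Ty,Ty)+G(Ty,Tx,Tx)\le \alpha\,[G(x,y,y)+G(y,x,x)+G(Tx,Ty,Ty)+G(Ty,Tx,Tx)].$$ For $\epsilon>0$, a point $x_0\in\bigcup_{i=1}^m X_i$ is an $\epsilon$-fixed point of $T$ if $G(x_0,Tx_0,Tx_0)+G(Tx_0,x_0,x_0)<\epsilon$.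 *)

(* Defs.v *)
From mathcomp Require Import all_boot all_order all_algebra.
From mathcomp Require Import classical_sets functions reals.
Set Implicit Arguments.
Unset Strict Implicit.
Unset Printing Implicit Defensive.
Import Order.TTheory GRing.Theory Num.Theory.
Local Open Scope classical_set_scope.
Local Open Scope ring_scope.

Record is_Gmetric (R : realType) (X : Type) (G : X -> X -> X -> R) : Prop :=
  IsGmetric {
    Gmetric_nonempty : [set: X] !=set0 ;
    Gmetric_ge0 : forall x y z, 0 <= G x y z ;
    Gmetric_eq0 : forall x y z, G x y z = 0 <-> x = y /\ y = z ;
    Gmetric_gt0 : forall x y, x <> y -> 0 < G x x y ;
    Gmetric_le : forall x y z, z <> y -> G x x y <= G x y z ;
    Gmetric_sym : forall x y z,
      [/\ G x y z = G x z y, G x y z = G y x z, G x y z = G y z x,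
          G x y z = G z x y & G x y z = G z y x] ;
    Gmetric_triangle : forall x y z a, G x y z <= G x a a + G a y z
  }.

(* The sets X_1, ..., X_m are [A i] for [i : 'I_m], shifted to start at 0. *)
Definition cyc_union (X : Type) (m : nat) (A : 'I_m -> set X) : set X :=
  \bigcup_i A i.

(* An operator on the union is a function on the subtype [cyc_union A];
   [ordS] is the successor modulo m, i.e. the convention X_{m+1} = X_1. *)
Definition cyclical (X : Type) (m : nat) (A : 'I_m -> set X)
    (T : cyc_union A -> cyc_union A) : Prop :=
  forall (i : 'I_m) (x : cyc_union A), A i (val x) -> A (ordS i) (val (T x)).

Definition G_Mohseni (R : realType) (X : Type) (G : X -> X -> X -> R)
    (m : nat) (A : 'I_m -> set X) (T : cyc_union A -> cyc_union A) : Prop :=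
  cyclical T /\
  exists alpha : R, 0 < alpha < 2^-1 /\
    forall (i : 'I_m) (x y : cyc_union A),
      A i (val x) -> A (ordS i) (val y) ->
      G (val (T x)) (val (T y)) (val (T y)) +
        G (val (T y)) (val (T x)) (val (T x))
      <= alpha * (G (val x) (val y) (val y) + G (val y) (val x) (val x) +
                  G (val (T x)) (val (T y)) (val (T y)) +
                  G (val (T y)) (val (T x)) (val (T x))).

Definition eps_fixed_point (R : realType) (X : Type) (G : X -> X -> X -> R)
    (m : nat) (A : 'I_m -> set X) (T : cyc_union A -> cyc_union A)
    (eps : R) (x0 : cyc_union A) : Prop :=
  G (val x0) (val (T x0)) (val (T x0)) + G (val (T x0)) (val x0) (val x0) < eps.

(* Main.v *)
Require Import Defs.
From mathcomp Require Import all_boot all_order all_algebra.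
From mathcomp Require Import classical_sets functions reals.
From mathcomp Require Import boolp lra.
Import Order.TTheory GRing.Theory Num.Theory.
Local Open Scope classical_set_scope.
Local Open Scope ring_scope.

(** Write [d x y] for the symmetrization [G x y y + G y x x]. Consecutive
    points of an orbit started in some [A i] lie in consecutive sets, so the
    contraction condition applies to the pair [(x, T x)] and reads
    [d (T x) (T (T x)) <= alpha * (d x (T x) + d (T x) (T (T x)))]; that is,
    the displacement [d x (T x)] is multiplied by at most
    [alpha / (1 - alpha)] at each step ([G_Mohseni_displacement]), and this
    ratio is less than [1] because [alpha < 1/2]. Such a sequence cannot stay
    above a positive [eps] ([contracting_seq_lt]), and a point of the orbit
    where it drops below [eps] is an [eps]-fixed point. *)

(** As long as the sequence stays above [eps], each step lowers it by at least
    the fixed amount [(1 - k) * eps], so by the Archimedean property it would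
    eventually become negative. *)
Lemma contracting_seq_lt (R : archiRealFieldType) (u : nat -> R) (k eps : R) :
  k < 1 -> 0 < eps -> (forall n, u n.+1 <= k * u n) -> exists n, u n < eps.
Proof.
move=> k1 eps0 uk; apply: contrapT => /forallNP u_ge.
have {}u_ge n : eps <= u n by rewrite leNgt; apply/negP.
have c0 : 0 < (1 - k) * eps by rewrite mulr_gt0// subr_gt0.
have u_drop n : u n <= u 0%N - (1 - k) * eps *+ n.
  elim: n => [|n IHn]; first by rewrite mulr0n subr0.
  have := uk n; have : 0 <= (1 - k) * (u n - eps).
    by rewrite mulr_ge0// subr_ge0// ltW.
  by rewrite mulrSr; lra.
have u0_ge0 : 0 <= u 0%N / ((1 - k) * eps).
  by rewrite divr_ge0 ?(ltW c0)// (le_trans (ltW eps0)).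
have := archi_boundP u0_ge0; set n := Num.Def.archi_bound _.
rewrite ltr_pdivrMr// mulr_natl => u0_lt.
by have := u_drop n; have := u_ge n; lra.
Qed.

Lemma cyclical_iter (X : Type) (m : nat) (A : 'I_m -> set X)
    (T : cyc_union A -> cyc_union A) (i : 'I_m) (x : cyc_union A) (n : nat) :
  cyclical T -> A i (val x) -> A (iter n (@ordS m) i) (val (iter n T x)).
Proof. by move=> cT Ax; elim: n => //= n; exact: cT. Qed.

(** The new displacement occurs on both sides of the contraction condition at
    [(x, T x)]; solving for it turns the constant [alpha < 1/2] into the ratio
    [alpha / (1 - alpha) < 1]. *)
Lemma G_Mohseni_displacement (R : realType) (X : Type) (G : X -> X -> X -> R)
    (m : nat) (A : 'I_m -> set X) (T : cyc_union A -> cyc_union A) :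
  G_Mohseni G T ->
  exists2 k : R, k < 1 & forall (i : 'I_m) (x : cyc_union A), A i (val x) ->
    G (val (T x)) (val (T (T x))) (val (T (T x))) +
      G (val (T (T x))) (val (T x)) (val (T x))
    <= k * (G (val x) (val (T x)) (val (T x)) +
            G (val (T x)) (val x) (val x)).
Proof.
move=> [cT [alpha [/andP[_ alpha_lt] contr]]].
have alpha1 : 0 < 1 - alpha by lra.
exists (alpha / (1 - alpha)); first by rewrite ltr_pdivrMr//; lra.
move=> i x Aix; have := contr i x (T x) Aix (cT i x Aix).
by rewrite mulrAC ler_pdivlMr//; lra.
Qed.

Theorem theorem4p7 (R : realType) (X : Type) (G : X -> X -> X -> R)
    (hG : is_Gmetric G) (m : nat) (hm : (1 <= m)%N) (A : 'I_m -> set X)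
    (hA : forall i : 'I_m, A i !=set0)
    (T : cyc_union A -> cyc_union A) (hT : G_Mohseni G T) :
  forall eps : R, 0 < eps ->
    exists x0 : cyc_union A, eps_fixed_point G T eps x0.
Proof.
move=> eps eps0; have [k k1 shrink] := G_Mohseni_displacement _ _ _ _ _ _ hT.
pose i0 := Ordinal hm; have [a Aa] := hA i0.
have Ua : a \in cyc_union A by apply/mem_set; exists i0.
pose orbit n := iter n T (SigSub Ua).
have orbit_in n : A (iter n (@ordS m) i0) (val (orbit n)).
  by apply: cyclical_iter => //; case: hT.
pose disp (x : cyc_union A) :=
  G (val x) (val (T x)) (val (T x)) + G (val (T x)) (val x) (val x).
have [n n_lt] := contracting_seq_lt R (disp \o orbit) k eps k1 eps0
  (fun n => shrink _ _ (orbit_in n)).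
by exists (orbit n).
Qed.
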